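(* Let $F$ be a minimally unsatisfiable clause-set. Then every maximal singular tuple $(v_1,\dots,v_m)$ for $F$ has length $m = \mathrm{singind}(F)$; that is, all maximal singular tuples for $F$ have the same length.
   Context: Literals are variables $v$ and complements $\overline{v}$; a clause is a finite set of literals with no complementary pair; a clause-set is a finite set of clauses; $\mathrm{var}(F)$ is the set of variables occurring in $F$; $\mathrm{ldeg}_F(x)$ is the number of clauses of $F$ containing literal $x$. DP-reduction: $\mathrm{DP}_v(F) := \{C \in F : v \notin \mathrm{var}(C)\} \cup \{(C \cup D)\setminus\{v,\overline{v}\} : C, D \in F,\ C \cap \overline{D} = \{v\}\}$, and $\mathrm{DP}_{v_1,\dots,v_n}(F)$ denotes applying $\mathrm{DP}_{v_1}$, then $\mathrm{DP}_{v_2}$, ..., then $\mathrm{DP}_{v_n}$ (for $n=0$ it is $F$). $\mathrm{MU}$ is the set of minimally unsatisfiable clause-sets. A variable $v$ is singular for $F$ if $\min(\mathrm{ldeg}_F(v),\mathrm{ldeg}_F(\overline{v}))=1$; $F$ is nonsingular if it has no singular variables. For $F\in\mathrm{MU}$, a tuple $(v_1,\dots,v_n)$ of variables ($n\ge 0$) is a singular tuple for $F$ if for every $i$, $v_i$ is singular for $\mathrm{DP}_{v_1,\dots,v_{i-1}}(F)$; it is maximal if $\mathrm{DP}_{v_1,\dots,v_n}(F)$ is nonsingular. The singularity index $\mathrm{singind}(F)$ is the minimal $n$ such that a maximal singular tuple of length $n$ exists for $F$. *)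

(* Defs.v *)
From mathcomp Require Import all_boot.
From mathcomp Require Import finmap.
Set Implicit Arguments. Unset Strict Implicit. Unset Printing Implicit Defensive.
Local Open Scope fset_scope.

Definition lit := (nat * bool)%type.
Definition comp (x : lit) : lit := (x.1, ~~ x.2).
Definition pos (v : nat) : lit := (v, true).
Definition neg (v : nat) : lit := (v, false).

Definition clause := {fset lit}.
Definition clauseset := {fset clause}.

Definition is_clause (C : clause) : Prop := forall x, x \in C -> comp x \notin C.
Definition is_clauseset (F : clauseset) : Prop := forall C, C \in F -> is_clause C.

Definition varC (C : clause) : {fset nat} := [fset x.1 | x in C].
Definition varF (F : clauseset) : {fset nat} := \bigcup_(C <- F) varC C.

Definition occ (F : clauseset) (x : lit) : {fset clause} := [fset C in F | x \in C].
Definition ldeg (F : clauseset) (x : lit) : nat := #|` occ F x |.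

Definition sat_clause (f : nat -> bool) (C : clause) : bool :=
  [exists x : C, f (val x).1 == (val x).2].
Definition satisfiable (F : clauseset) : Prop :=
  exists f : nat -> bool, forall C, C \in F -> sat_clause f C.

Definition MU (F : clauseset) : Prop :=
  is_clauseset F /\ ~ satisfiable F /\ (forall C, C \in F -> satisfiable (F `\ C)).

Definition DP (v : nat) (F : clauseset) : clauseset :=
  [fset C in F | v \notin varC C] `|`
  [fset (CD.1 `|` CD.2) `\` [fset pos v; neg v]
     | CD in F `*` F & (CD.1 `&` [fset comp x | x in CD.2]) == [fset pos v]].

Definition DPs (F : clauseset) (s : seq nat) : clauseset :=
  foldl (fun G v => DP v G) F s.

Definition singular (F : clauseset) (v : nat) : Prop :=
  minn (ldeg F (pos v)) (ldeg F (neg v)) = 1.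
Definition nonsingular (F : clauseset) : Prop := forall v, ~ singular F v.

Definition singular_tuple (F : clauseset) (s : seq nat) : Prop :=
  forall i, i < size s -> singular (DPs F (take i s)) (nth 0 s i).

Definition maximal_singular_tuple (F : clauseset) (s : seq nat) : Prop :=
  singular_tuple F s /\ nonsingular (DPs F s).

Definition is_singind (F : clauseset) (n : nat) : Prop :=
  (exists s, maximal_singular_tuple F s /\ size s = n) /\
  (forall s, maximal_singular_tuple F s -> n <= size s).

(* Main.v *)
(* Call the unique clause C containing a literal x of degree one the main clause
   of x.  In a minimally unsatisfiable F, C clashes with each clause containing
   the complement of x only in x, and D |-> D or D |-> (C u D) - {x, comp x} is
   a bijection from F - {C} onto DP_x(F).  Hence DP_x(F) is again minimally
   unsatisfiable, has one clause less, preserves the degrees of literals outside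
   C, and gives literals of C at least the degree of comp x.

   Reductions by two singular variables v, w commute, so if each remains singular
   after reducing the other, they form a diamond and induction on the number of
   clauses applies.  Otherwise v and w have literals of degree one with the same
   main clause and complements of degree at least two.  Then reducing v creates
   no new singular variables, and each variable u singular in DP_v(F) forms a
   diamond with v and also with w, so the lengths agree through DP_u(F); if there is
   no such u, both DP_v(F) and DP_w(F) are nonsingular. *)
From Pilot Require (* [ssrfun.comp] shadows [Defs.comp]. *)
Import Defs.
From mathcomp Require Import all_boot.
From mathcomp Require Import finmap.
From Stdlib Require Import Classical.
Import Defs.

Set Implicit Arguments. Unset Strict Implicit. Unset Printing Implicit Defensive.
Local Open Scope fset_scope.

(** * Literals and modified assignments *)

Lemma compK : involutive comp.
Proof. by case=> v b; rewrite /comp /= negbK. Qed.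

Lemma lit_same_var (x y : lit) : y.1 = x.1 -> y = x \/ y = comp x.
Proof.
case: x y => v b [w c] /= ->; rewrite /comp /=.
by case: b; case: c; [left | right | right | left].
Qed.

Lemma varCP (v : nat) (C : clause) :
  reflect (exists2 y, y \in C & y.1 = v) (v \in varC C).
Proof.
by apply: (iffP (imfsetP _ _ _ _)) => -[y yC yv]; exists y.
Qed.

Lemma sat_clauseP (f : nat -> bool) (C : clause) :
  reflect (exists2 y, y \in C & f y.1 = y.2) (sat_clause f C).
Proof.
apply: (iffP existsP) => [[y /eqP fy]|[y yC fy]].
  by exists (val y) => //; exact: valP.
by exists [` yC]; apply/eqP.
Qed.

Definition set_true (f : nat -> bool) (x : lit) (v : nat) : bool :=
  if v == x.1 then x.2 else f v.

Lemma set_true_same f (x : lit) : set_true f x x.1 = x.2.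
Proof. by rewrite /set_true eqxx. Qed.

Lemma set_true_other f (x y : lit) :
  y.1 != x.1 -> set_true f x y.1 = f y.1.
Proof. by rewrite /set_true => /negbTE ->. Qed.

Lemma sat_set_true_mem f (x : lit) (C : clause) :
  x \in C -> sat_clause (set_true f x) C.
Proof. by move=> xC; apply/sat_clauseP; exists x; rewrite ?set_true_same. Qed.

Lemma sat_set_true f (x : lit) (C : clause) :
  comp x \notin C -> sat_clause f C -> sat_clause (set_true f x) C.
Proof.
move=> ncx /sat_clauseP [y yC fy]; case: (eqVneq y.1 x.1) => [|yx].
  case/lit_same_var=> ?; subst y; first exact: sat_set_true_mem.
  by rewrite yC in ncx.
by apply/sat_clauseP; exists y; rewrite ?set_true_other.
Qed.

(** * Clashes, resolvents and membership in a DP-reduction *)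

Definition clash (x : lit) (C D : clause) : Prop :=
  [/\ x \in C, comp x \in D & forall y, y \in C -> comp y \in D -> y = x].

Lemma clash_sym x C D : clash x C D -> clash (comp x) D C.
Proof.
case=> xC xD h; split=> //; first by rewrite compK.
by move=> y yD yC; rewrite -(h (comp y)) ?compK.
Qed.

Definition resolvent (v : nat) (C D : clause) : clause :=
  (C `|` D) `\` [fset pos v; neg v].

Lemma in_resolvent v C D (y : lit) :
  (y \in resolvent v C D) = (y.1 != v) && ((y \in C) || (y \in D)).
Proof.
rewrite !inE; congr (~~ _ && _).
by case: y => w [] /=; rewrite /pos /neg !xpair_eqE /= ?andbT ?andbF ?orbF.
Qed.

Lemma resolventC v C D : resolvent v C D = resolvent v D C.
Proof. by rewrite /resolvent fsetUC. Qed.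

(** Gives access to the elementwise [clash], which makes sense for a literal of either sign. *)
Lemma clash_posP v (C D : clause) :
  C `&` [fset comp x | x in D] == [fset pos v] <-> clash (pos v) C D.
Proof.
have cE y : (y \in [fset comp x | x in D]) = (comp y \in D).
  apply/imfsetP/idP => [[z /= zD ->]|yD]; first by rewrite compK.
  by exists (comp y); rewrite ?compK.
split=> [/eqP/fsetP e|[vC vD h]].
  split=> [||y yC yD].
  - by have := e (pos v); rewrite in_fsetI cE in_fset1 eqxx => /andP [].
  - by have := e (pos v); rewrite in_fsetI cE in_fset1 eqxx => /andP [].
  - by have := e y; rewrite in_fsetI cE in_fset1 yC yD => /esym/eqP.
apply/eqP/fsetP=> y; rewrite in_fsetI cE in_fset1.
apply/andP/eqP => [[yC yD]|->]; [exact: h | by split].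
Qed.

(** Exchanging the parents turns a clash in [pos v] into one in [neg v] and keeps the resolvent, so
    the reduction may be read from either literal of the variable. This spares all later case
    distinctions on signs. *)
Lemma DP_P (x : lit) (F : clauseset) (E : clause) :
  E \in DP x.1 F <->
  (E \in F /\ x.1 \notin varC E) \/
  (exists C D, [/\ C \in F, D \in F, clash x C D & E = resolvent x.1 C D]).
Proof.
rewrite /DP in_fsetU !inE /=.
split.
  case/orP=> [/andP [EF nv]|/imfsetP [[C D]]]; first by left.
  rewrite /= !inE /= => /andP [/andP [CF DF] /clash_posP cl] ->; right.
  case: x cl => v [] /= cl; first by exists C, D.
  exists D, C; split=> //; first exact: (clash_sym cl).
  by rewrite resolventC.
case=> [[-> ->] //|[C [D [CF DF cl ->]]]].
apply/orP; right; apply/imfsetP.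
case: x cl => v [] /= cl.
  exists (C, D) => //=; rewrite !inE /= CF DF; exact/clash_posP.
exists (D, C) => //=; last by rewrite -resolventC.
rewrite !inE /= CF DF; apply/clash_posP; exact: (clash_sym cl).
Qed.

Lemma in_occ (F : clauseset) (x : lit) D :
  (D \in occ F x) = (D \in F) && (x \in D).
Proof. by rewrite !inE. Qed.

Lemma ldeg1P (F : clauseset) (x : lit) :
  ldeg F x = 1 <->
  exists C, [/\ C \in F, x \in C & forall D, D \in F -> x \in D -> D = C].
Proof.
split=> [/eqP/cardfs1P [C e]|[C [CF xC h]]].
  have eD D : (D \in F) && (x \in D) = (D == C).
    by have /fsetP/(_ D) := e; rewrite !inE /=.
  have /andP [CF xC] : (C \in F) && (x \in C) by rewrite eD.
  by exists C; split=> // D DF xD; apply/eqP; rewrite -eD DF.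
apply/eqP/cardfs1P; exists C; apply/fsetP => D; rewrite !inE /=.
by apply/andP/eqP => [[]|->] //; exact: h.
Qed.

Lemma ldeg_gt0 (F : clauseset) (x : lit) C :
  C \in F -> x \in C -> 0 < ldeg F x.
Proof. by move=> CF xC; rewrite cardfs_gt0; apply/fset0Pn; exists C; rewrite !inE /= CF. Qed.

Lemma in_DP_var_free (F : clauseset) v (C : clause) :
  C \in F -> (forall y, y \in C -> y.1 != v) -> C \in DP v F.
Proof.
move=> CF nv; apply/(DP_P (pos v)); left; split=> //.
by apply/varCP => -[y yC /eqP]; apply/negP; exact: nv.
Qed.

Lemma in_DP_resolvent (F : clauseset) (x : lit) C D :
  C \in F -> D \in F -> clash x C D -> resolvent x.1 C D \in DP x.1 F.
Proof. by move=> CF DF cl; apply/DP_P; right; exists C, D. Qed.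

Lemma clause_var_free (C : clause) (z : lit) :
  z \notin C -> comp z \notin C -> forall y, y \in C -> y.1 != z.1.
Proof.
move=> nz ncz y yC; apply/eqP => /lit_same_var [] e.
  by rewrite -e yC in nz.
by rewrite -e yC in ncz.
Qed.

(** Resolution on [x] and then on [z] is reordered: the parents containing [z] are first resolved
    with [B], and the results are resolved on [x]. *)
Lemma resolvent_swap (F : clauseset) (x z : lit) (C D B : clause) :
  [/\ C \in F, D \in F & B \in F] -> is_clause B ->
  clash x C D -> z.1 != x.1 ->
  (forall y, y \in B -> y.1 != x.1) -> z \in C ->
  clash z (resolvent x.1 C D) B ->
  resolvent z.1 (resolvent x.1 C D) B \in DP x.1 (DP z.1 F).
Proof.
move=> [CF DF BF] clB [xC xD cl] zx nvB zC [_ zB clRB].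
have xz : x.1 != z.1 by rewrite eq_sym.
have clashB y : (y \in C) || (y \in D) -> comp y \in B -> y = z.
  by move=> yCD yB; apply: clRB; rewrite // in_resolvent (nvB _ yB).
have clash_z E : z \in E -> (forall y, y \in E -> (y \in C) || (y \in D)) ->
    clash z E B.
  by move=> zE sub; split=> // y /sub; exact: clashB.
have zD : comp z \notin D by apply: contraNN zx => zD; rewrite (cl z).
(* If [z] lies in [D] as well, both parents have to be resolved with [B]. Otherwise [D] is free of
   the variable of [z] and survives the reduction unchanged. *)
pose E := if z \in D then resolvent z.1 D B else D.
have EDP : E \in DP z.1 F.
  rewrite /E; case: ifP => [zD'|/negbT zD'].
    by apply: in_DP_resolvent => //; apply: clash_z => // y ->; rewrite orbT.
  by apply: in_DP_var_free => //; exact: clause_var_free.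
have -> : resolvent z.1 (resolvent x.1 C D) B = resolvent x.1 (resolvent z.1 C B) E.
  apply/fsetP => y; have nvBy := nvB y; rewrite /E; case: ifP => [_|/negbT zD'].
    rewrite !in_resolvent; case: (y \in B) nvBy => [/(_ isT) ->|_] /=.
      by case: (y.1 != z.1); rewrite ?orbT ?andbF.
    by case: (y.1 != z.1); case: (y.1 != x.1); case: (y \in C); case: (y \in D).
  have := @clause_var_free D z zD' zD y.
  rewrite !in_resolvent; case: (y \in B) nvBy => [/(_ isT) ->|_] /=.
    by case: (y \in D) => [/(_ isT) ->|_]; rewrite ?orbT ?orbF.
  case: (y \in D) => [/(_ isT) ->|_]; rewrite ?orbT ?orbF //.
  by case: (y.1 != z.1); case: (y.1 != x.1).
apply: in_DP_resolvent => //.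
  by apply: in_DP_resolvent => //; apply: clash_z => // y ->.
split; first by rewrite in_resolvent xz xC.
  by rewrite /E; case: ifP => // _; rewrite in_resolvent xz xD.
move=> y; rewrite in_resolvent => /andP [yz yCB] yE.
have {yE} : (comp y \in D) || (comp y \in B).
  by move: yE; rewrite /E; case: ifP => [_|_ ->//]; rewrite in_resolvent => /andP [].
case/orP: yCB => [yC|yB] /orP [yD|yB'].
- exact: cl.
- by rewrite (clashB y) ?yC ?eqxx in yz.
- have e : comp y = z by apply: clashB; rewrite ?yD ?orbT ?compK.
  by rewrite -e /= eqxx in yz.
- by have := clB _ yB; rewrite yB'.
Qed.

(** * Singular DP-reduction of a minimally unsatisfiable clause-set *)

Lemma MU_witness (F : clauseset) D : MU F -> D \in F ->
  exists f, ~~ sat_clause f D /\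
            forall E, E \in F -> E != D -> sat_clause f E.
Proof.
move=> [_ [unsat min]] DF; have [f hf] := min _ DF.
have hE E : E \in F -> E != D -> sat_clause f E.
  by move=> EF ED; apply: hf; rewrite !inE ED.
exists f; split=> //; apply/negP => fD; apply: unsat; exists f => E EF.
by case: (eqVneq E D) => [->|/(hE E EF)].
Qed.

(** An assignment that fails only on [C] can be changed to make [x] true, which harms only clauses
    containing [comp x]. Without such clauses [F] would be satisfied. *)
Lemma MU_no_pure (F : clauseset) x C : MU F -> C \in F -> x \in C ->
  exists2 D, D \in F & comp x \in D.
Proof.
move=> mu CF xC; have [f [_ hf]] := MU_witness mu CF.
apply: NNPP => no; case: mu => _ [unsat _]; apply: unsat.
exists (set_true f x) => D DF; case: (eqVneq D C) => [->|DC].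
  exact: sat_set_true_mem.
apply: sat_set_true (hf _ DF DC).
by apply/negP => xD; apply: no; exists D.
Qed.

(** One literal of degree one suffices: its complement also occurs, so the minimum cannot drop to
    zero. *)
Lemma singularP (F : clauseset) v : MU F ->
  singular F v <-> exists2 x : lit, x.1 = v & ldeg F x = 1.
Proof.
move=> mu; rewrite /singular; split=> [|[x <- d1]].
  by rewrite /minn; case: ifP => _ d; [exists (pos v) | exists (neg v)].
have d2 : 0 < ldeg F (comp x).
  have [C [CF xC _]] := (ldeg1P F x).1 d1.
  by have [D DF xD] := MU_no_pure mu CF xC; exact: ldeg_gt0 DF xD.
case: x d1 d2 => v' [] /= d1 d2.
  by rewrite [pos v'](erefl (v', true)) d1; apply/minn_idPl.
by rewrite [neg v'](erefl (v', false)) d1; apply/minn_idPr.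
Qed.

Definition main_clause (F : clauseset) (x : lit) (C : clause) : Prop :=
  [/\ C \in F, x \in C & forall D, D \in F -> x \in D -> D = C].

Section Reduction.

Variables (F : clauseset) (x : lit) (C : clause).
Hypotheses (mu : MU F) (mainC : main_clause F x C).

Let clF : is_clauseset F := proj1 mu.
Let CF : C \in F. Proof. by case: mainC. Qed.
Let xC : x \in C. Proof. by case: mainC. Qed.

Lemma side_no_main (D : clause) : D \in F -> D != C -> x \notin D.
Proof. by case: mainC => _ _ h DF; apply: contraNN => xD; apply/eqP; exact: h. Qed.

Lemma comp_notin_main : comp x \notin C.
Proof. exact: clF CF _ xC. Qed.

Lemma side_neq_main (D : clause) : comp x \in D -> D != C.
Proof. by move=> xD; apply/eqP => e; have := comp_notin_main; rewrite -e xD. Qed.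

(* Otherwise making [x] false would satisfy all of [F]. *)
Lemma witness_falsifies_main f (D : clause) : D \in F -> comp x \in D ->
  ~~ sat_clause f D -> (forall E, E \in F -> E != D -> sat_clause f E) ->
  forall y, y \in C -> y != x -> f y.1 != y.2.
Proof.
move=> DF xD nfD hf y yC yx; apply/eqP => fy.
case: mu => _ [unsat _]; apply: unsat; exists (set_true f (comp x)) => E EF.
case: (boolP (comp x \in E)) => [xE|nxE]; first exact: sat_set_true_mem.
case: (eqVneq E C) => [->|EC].
  apply/sat_clauseP; exists y => //.
  rewrite (@set_true_other f (comp x) y) //=; apply/eqP => e.
  case: (lit_same_var e) => e'; first by rewrite e' eqxx in yx.
  by have := comp_notin_main; rewrite -e' yC.
apply: sat_set_true; first by rewrite compK; exact: side_no_main.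
by apply: hf => //; apply: contraNneq nxE => ->.
Qed.

(** An assignment failing only on [D] falsifies every literal of [C] other than [x]. A second
    clashing literal [y] of [C] would then be false, so [comp y] would satisfy [D]. *)
Lemma clash_main_side (D : clause) : D \in F -> comp x \in D -> clash x C D.
Proof.
move=> DF xD; split=> // y yC yD; apply/eqP/negPn/negP => yx.
have [f [nfD hf]] := MU_witness mu DF.
have fy := witness_falsifies_main DF xD nfD hf yC yx.
case/negP: nfD; apply/sat_clauseP; exists (comp y) => //=.
by case: (f y.1) (y.2) fy => [] [].
Qed.

Definition reduct (D : clause) : clause :=
  if comp x \in D then resolvent x.1 C D else D.

Lemma in_reduct (D : clause) (y : lit) : D \in F -> D != C -> y.1 != x.1 ->
  (y \in reduct D) = (y \in D) || (comp x \in D) && (y \in C).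
Proof.
move=> DF DC yx; rewrite /reduct; case: ifP => [_|]; last by rewrite orbF.
by rewrite in_resolvent yx orbC.
Qed.

Lemma reduct_no_var (D : clause) (y : lit) : D \in F -> D != C -> y \in reduct D -> y.1 != x.1.
Proof.
move=> DF DC; rewrite /reduct; case: ifP => [_|xD yD].
  by rewrite in_resolvent => /andP [].
apply/eqP => /lit_same_var [] e; last by rewrite -e yD in xD.
by have := side_no_main DF DC; rewrite -e yD.
Qed.

Lemma DP_reductP E :
  E \in DP x.1 F <-> exists D, [/\ D \in F, D != C & E = reduct D].
Proof.
rewrite DP_P; split.
  case=> [[EF nv]|[C' [D [C'F DF [xC' xD _] ->]]]].
    exists E; split=> //.
      by apply: contraNneq nv => ->; apply/varCP; exists x.
    rewrite /reduct; case: ifP => // xE.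
    by case/varCP: nv; exists (comp x).
  exists D; split; rewrite /reduct ?xD ?side_neq_main //.
  by case: mainC => _ _ /(_ C' C'F xC') ->.
case=> D [DF DC ->]; case: (boolP (comp x \in D)) => xD.
  by right; exists C, D; split=> //; [exact: clash_main_side | rewrite /reduct xD].
have e : reduct D = D by rewrite /reduct (negbTE xD).
left; rewrite e; split=> //; apply/varCP => -[y yD yx].
by have := @reduct_no_var D y DF DC; rewrite e yx eqxx => /(_ yD).
Qed.

Lemma sat_reduct f (D : clause) : D \in F -> D != C ->
  sat_clause f C -> sat_clause f D -> sat_clause f (reduct D).
Proof.
move=> DF DC /sat_clauseP [c cC fc] /sat_clauseP [d dD fd].
rewrite /reduct; case: ifP => [xD|_]; last by apply/sat_clauseP; exists d.
(* If the true literal of [D] has the variable of [x], it is [comp x]; then the true literal of [C]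
   is not [x] and survives in the resolvent. *)
apply/sat_clauseP; case: (eqVneq d.1 x.1) => [dx|dx]; last first.
  by exists d => //; rewrite in_resolvent dx dD orbT.
exists c => //; rewrite in_resolvent cC andbT; apply/eqP => cx.
case: (lit_same_var cx) => ec; last by have := comp_notin_main; rewrite -ec cC.
case: (lit_same_var dx) => ed.
  by have := side_no_main DF DC; rewrite -ed dD.
by move: fd; rewrite ed /= -ec fc; case: (c.2).
Qed.

(** The assignment failing only on [D] serves: it satisfies [C], hence the other reducts by
    soundness of resolution, and whatever [reduct D] inherits from [C] is false. These witnesses
    yield both the injectivity of [reduct] and the minimality of the reduced clause-set. *)
Lemma witness_reduct (D : clause) : D \in F -> D != C ->
  exists f, ~~ sat_clause f (reduct D) /\
    forall E, E \in F -> E != C -> E != D -> sat_clause f (reduct E).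
Proof.
move=> DF DC; have [f [nfD hf]] := MU_witness mu DF.
exists f; split; last first.
  by move=> E EF EC ED; apply: sat_reduct => //; apply: hf => //; rewrite eq_sym.
apply/sat_clauseP => -[y yR fy].
have yx := reduct_no_var DF DC yR.
move: yR; rewrite in_reduct // => /orP [yD|/andP [xD yC]].
  by case/sat_clauseP: nfD; exists y.
have /eqP[] // : f y.1 != y.2.
by apply: (witness_falsifies_main DF) => //; apply: contraNneq yx => ->.
Qed.

Lemma reduct_inj : {in F `\ C &, injective reduct}.
Proof.
move=> D E; rewrite !inE => /andP [DC DF] /andP [EC EF] e.
have [f [nf hf]] := witness_reduct DF DC.
apply/eqP/negPn/negP => DE; case/negP: nf.
by rewrite e; apply: hf => //; rewrite eq_sym.
Qed.

Lemma DP_reduct : DP x.1 F = [fset reduct D | D in F `\ C].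
Proof.
apply/fsetP=> E; apply/idP/imfsetP => [/DP_reductP [D [DF DC ->]]|[D]].
  by exists D => //; rewrite /= !inE DC.
by rewrite in_fsetD1 => /andP [DC DF] ->; apply/DP_reductP; exists D.
Qed.

Lemma card_DP : (#|` DP x.1 F|).+1 = #|` F|.
Proof.
rewrite DP_reduct card_in_imfset /=; last exact: reduct_inj.
by rewrite (cardfsD1 C F) CF.
Qed.

Lemma MU_DP : MU (DP x.1 F).
Proof.
split; last split.
- move=> E /DP_reductP [D [DF DC ->]] y; rewrite /reduct; case: ifP => [xD|_]; last exact: clF.
  have [_ _ h] := clash_main_side DF xD.
  rewrite !in_resolvent => /andP [yx yCD]; rewrite negb_and negb_or yx /=.
  case/orP: yCD => yCD.
    rewrite (clF CF yCD) /=; apply: contraNN yx => yD.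
    by rewrite (h _ yCD yD).
  rewrite (clF DF yCD) andbT; apply: contraNN yx => yC.
  by rewrite -(h _ yC) ?compK.
- case=> f hf; case: mu => _ [unsat _]; apply: unsat.
  have hR D : D \in F -> D != C -> sat_clause f (reduct D).
    by move=> DF DC; apply: hf; apply/DP_reductP; exists D.
  (* A model of the reducts is turned into a model of [F]. If [C] is satisfied without [x], then [x]
     is made false. Otherwise [x] is made true, and the true literal of each reduct must come from
     its original clause, not from [C]. *)
  case: (boolP (sat_clause f (C `\ x))) => [/sat_clauseP [c]|nfC].
    rewrite !inE => /andP [cx cC] fc.
    exists (set_true f (comp x)) => D DF.
    case: (boolP (comp x \in D)) => xD; first exact: sat_set_true_mem.
    case: (eqVneq D C) => [->|DC].
      apply/sat_clauseP; exists c => //.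
      rewrite (@set_true_other f (comp x) c) //=; apply/eqP => e.
      case: (lit_same_var e) => e'; first by rewrite e' eqxx in cx.
      by have := comp_notin_main; rewrite -e' cC.
    apply: sat_set_true; first by rewrite compK; exact: side_no_main.
    by have := hR D DF DC; rewrite /reduct (negbTE xD).
  exists (set_true f x) => D DF; case: (eqVneq D C) => [->|DC].
    exact: sat_set_true_mem.
  have /sat_clauseP [y yR fy] := hR D DF DC.
  have yx := reduct_no_var DF DC yR.
  apply/sat_clauseP; exists y; last by rewrite set_true_other.
  move: yR; rewrite in_reduct // => /orP [//|/andP [_ yC]].
  case/sat_clauseP: nfC; exists y => //; rewrite !inE yC andbT.
  by apply: contraNneq yx => ->.
- move=> E /DP_reductP [D [DF DC ->]].
  have [f [_ hf]] := witness_reduct DF DC; exists f => E'.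
  rewrite in_fsetD1 => /andP [ne /DP_reductP [D' [D'F D'C e]]].
  rewrite e; apply: hf => //.
  by apply: contraNneq ne => <-; rewrite e.
Qed.

(** * Degrees of literals under reduction, and commutation of reductions *)

Lemma ldeg_DP (y : lit) : y.1 != x.1 ->
  ldeg (DP x.1 F) y =
  #|` [fset D in F `\ C | (y \in D) || (comp x \in D) && (y \in C)]|.
Proof.
move=> yx; set A := [fset D in _ | _].
have inA D : (D \in A) =
    [&& D != C, D \in F & (y \in D) || (comp x \in D) && (y \in C)].
  by rewrite !inE -andbA.
have injA : {in A &, injective reduct}.
  move=> D E; rewrite !inA => /and3P [DC DF _] /and3P [EC EF _].
  by apply: reduct_inj; rewrite in_fsetD1 ?DC ?EC.
transitivity #|` [fset reduct D | D in A]|; last exact: card_in_imfset.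
congr #|` _|; apply/fsetP => E; apply/idP/imfsetP => [|[D /=]].
  rewrite in_occ => /andP [/DP_reductP [D [DF DC ->]]].
  by rewrite in_reduct // => h; exists D => //=; rewrite inA DC DF.
rewrite inA in_occ => /and3P [DC DF h] ->.
by apply/andP; split; [apply/DP_reductP; exists D | rewrite in_reduct].
Qed.

Lemma ldeg_DP_notin (y : lit) : y.1 != x.1 -> y \notin C -> ldeg (DP x.1 F) y = ldeg F y.
Proof.
move=> yx yC; rewrite ldeg_DP //; congr #|` _|; apply/fsetP => D.
rewrite !inE (negbTE yC) andbF orbF /=.
by case: (eqVneq D C) => [->|]; rewrite ?(negbTE yC) ?andbF.
Qed.

(** Each clause containing [comp x] is resolved with [C] and thereby inherits [y]. *)
Lemma ldeg_DP_in (y : lit) : y.1 != x.1 -> y \in C -> ldeg F (comp x) <= ldeg (DP x.1 F) y.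
Proof.
move=> yx yC; rewrite ldeg_DP //; apply: fsubset_leq_card.
apply/fsubsetP => D; rewrite !inE yC /= => /andP [DF xD].
by rewrite side_neq_main // DF xD orbT.
Qed.

(** Outside [C] the literal [y] does not occur, so it appears after reduction exactly in the
    resolvents with [C]. *)
Lemma ldeg_DP_main (y : lit) : y.1 != x.1 -> main_clause F y C ->
  ldeg (DP x.1 F) y = ldeg F (comp x).
Proof.
move=> yx [_ yC yu]; rewrite ldeg_DP //; congr #|` _|; apply/fsetP => D.
rewrite !inE yC andbT /=; case: (boolP (D \in F)) => DF; rewrite ?andbF //=.
case: (boolP (comp x \in D)) => xD; first by rewrite side_neq_main // orbT.
rewrite orbF; apply/negbTE/andP => -[/andP [DC _] yD].
by rewrite (yu D DF yD) eqxx in DC.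
Qed.

Lemma var_notin_DP (y : lit) : y.1 = x.1 -> ldeg (DP x.1 F) y = 0.
Proof.
move=> yx; apply/eqP; rewrite cardfs_eq0; apply/eqP/fsetP => E.
rewrite in_occ in_fset0; apply/negbTE/andP => -[/DP_reductP [D [DF DC ->]]].
by move/(reduct_no_var DF DC); rewrite yx eqxx.
Qed.

(* For general clause-sets the inclusion fails; here the offending case, two
   resolvents [C, A0] and [C, B0] clashing in [w] with [w] occurring in [C], is
   excluded because [C] clashes with its side clauses only in [x]. *)
Lemma DP_comm_sub w : w != x.1 ->
  forall E, E \in DP w (DP x.1 F) -> E \in DP x.1 (DP w F).
Proof.
move=> wx E /(DP_P (pos w)).
have xw : x.1 != w by rewrite eq_sym.
case=> [[/DP_reductP [D [DF DC ->]] nw]|[A [B [/DP_reductP [A0 [A0F A0C ->]]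
  /DP_reductP [B0 [B0F B0C ->]]]]]].
  have nwR y : y \in reduct D -> y.1 != w.
    by move=> yD; apply: contraNneq nw => yw; apply/varCP; exists y.
  have := @reduct_no_var D; rewrite /reduct in nwR *; case: ifP nwR => xD nwR nv.
    have nwCD y : (y \in C) || (y \in D) -> y.1 != w.
      move=> yCD; case: (eqVneq y.1 x.1) => [-> //|yx].
      by apply: nwR; rewrite in_resolvent yx.
    apply: in_DP_resolvent; last exact: clash_main_side.
      by apply: in_DP_var_free => // y yC; apply: nwCD; rewrite yC.
    by apply: in_DP_var_free => // y yD; apply: nwCD; rewrite yD orbT.
  apply: in_DP_var_free; first exact: in_DP_var_free.
  by move=> y yD; apply: nv.
(* Exactly one parent is a resolvent with [C]. The clashing literal [z] comes from [C] or from [D],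
   and [resolvent_swap] is used with these two exchanged in the second case. *)
have mixed (z : lit) (D G : clause) : z.1 = w -> D \in F -> comp x \in D -> G \in F -> G != C ->
    comp x \notin G -> clash z (resolvent x.1 C D) G ->
    resolvent w (resolvent x.1 C D) G \in DP x.1 (DP w F).
  move=> zw DF xD GF GC nxG cl; have nvG := clause_var_free (side_no_main GF GC) nxG.
  have clCD := clash_main_side DF xD; have clG := clF GF.
  rewrite -zw in wx *; have [] := cl; rewrite in_resolvent => /andP [_ /orP []] zCD _ _.
    exact: resolvent_swap.
  rewrite (resolventC x.1) in cl *; apply: (@resolvent_swap _ (comp x)) => //.
  exact: clash_sym.
rewrite [reduct A0]/reduct [reduct B0]/reduct.
case: ifP => xA; case: ifP => xB cl ->.
- have clA := clash_main_side A0F xA; have clB := clash_main_side B0F xB.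
  have [_ _ hA] := clA; have [_ _ hB] := clB.
  have [] := cl; rewrite !in_resolvent !wx /= => zA zB h.
  have zC : pos w \notin C.
    apply: contraNN wx => zC; rewrite -(hB _ zC) //.
    by case/orP: zB => // zB; have := clF CF zC; rewrite zB.
  have zC' : neg w \notin C.
    apply: contraNN wx => zC'; rewrite -(hA _ zC') //.
    by rewrite (negbTE zC) in zA.
  rewrite (negbTE zC) in zA; rewrite (negbTE zC') in zB.
  have clAB : clash (pos w) A0 B0.
    split=> // y yA yB; case: (eqVneq y.1 x.1) => [|yx].
      case/lit_same_var => e; first by have := side_no_main A0F A0C; rewrite -e yA.
      by have := side_no_main B0F B0C; rewrite -[x]compK -e yB.
    by apply: h; rewrite in_resolvent /= yx ?yA ?yB orbT.
  have nwC : forall y, y \in C -> y.1 != w by apply: (@clause_var_free C (pos w)).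
  (* As [C] is free of [w], the two resolutions with [C] merge into a single one, performed after
     resolving [A0] with [B0]. *)
  have -> : resolvent w (resolvent x.1 C A0) (resolvent x.1 C B0) =
            resolvent x.1 C (resolvent w A0 B0).
    apply/fsetP => y; rewrite !in_resolvent; have := nwC y.
    case: (y \in C) => [/(_ isT) ->|_] /=; first by case: (y.1 != x.1).
    by case: (y.1 != x.1); case: (y.1 != w).
  apply: in_DP_resolvent; first exact: in_DP_var_free.
    exact: (@in_DP_resolvent F (pos w)).
  split=> //; first by rewrite in_resolvent /= xw xA.
  by move=> y yC; rewrite in_resolvent => /andP [_ /orP []]; [exact: hA | exact: hB].
- by apply: (mixed (pos w)); rewrite ?xB.
- rewrite resolventC; apply: (mixed (neg w)); rewrite ?xA //.
  exact: clash_sym cl.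
- have nvA := clause_var_free (side_no_main A0F A0C) (negbT xA).
  have nvB := clause_var_free (side_no_main B0F B0C) (negbT xB).
  apply: in_DP_var_free.
    exact: (@in_DP_resolvent F (pos w)).
  by move=> y; rewrite in_resolvent => /andP [_ /orP []]; [exact: nvA | exact: nvB].
Qed.

End Reduction.

(** * Reduction by singular variables *)

Lemma singular_main (F : clauseset) v : MU F -> singular F v ->
  exists x C, x.1 = v /\ main_clause F x C.
Proof.
move=> mu /(singularP v mu) [x xv /ldeg1P [C mainC]].
by exists x, C.
Qed.

Lemma main_ldeg (F : clauseset) x C : main_clause F x C -> ldeg F x = 1.
Proof. by move=> mainC; apply/ldeg1P; exists C. Qed.

Lemma MU_singular_DP (F : clauseset) v : MU F -> singular F v -> MU (DP v F).
Proof.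
move=> mu /(singular_main mu) [x [C [<- mainC]]]; exact: (MU_DP mu mainC).
Qed.

Lemma card_singular_DP (F : clauseset) v : MU F -> singular F v ->
  (#|` DP v F|).+1 = #|` F|.
Proof.
move=> mu /(singular_main mu) [x [C [<- mainC]]]; exact: (card_DP mu mainC).
Qed.

Lemma singular_DP_neq (F : clauseset) v w : MU F -> singular F v ->
  singular (DP v F) w -> w != v.
Proof.
move=> mu /(singular_main mu) [x [C [<- mainC]]].
rewrite /singular => sw; apply/eqP => e.
by move: sw; rewrite !(var_notin_DP mu mainC).
Qed.

Lemma DP_comm (F : clauseset) v w : MU F -> singular F v -> singular F w ->
  v != w -> DP w (DP v F) = DP v (DP w F).
Proof.
move=> mu /(singular_main mu) [x [C [<- mainC]]] /(singular_main mu) [y [D [<- mainD]]] xy.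
apply/fsetP => E; apply/idP/idP.
  by apply: (DP_comm_sub mu mainC); rewrite eq_sym.
exact: (DP_comm_sub mu mainD).
Qed.

(** * Pairs of singular variables that do not form a diamond *)

Definition blocked (F : clauseset) (x y : lit) : Prop :=
  [/\ x.1 != y.1, 1 < ldeg F (comp x), 1 < ldeg F (comp y) &
      exists2 C, main_clause F x C & main_clause F y C].

Lemma blocked_sym F x y : blocked F x y -> blocked F y x.
Proof.
by case=> xy dx dy [C mx my]; split; rewrite 1?eq_sym //; exists C.
Qed.

Lemma blockedP (F : clauseset) v w : MU F -> singular F v -> singular F w ->
  v != w -> ~ singular (DP v F) w ->
  exists x y, [/\ x.1 = v, y.1 = w & blocked F x y].
Proof.
move=> mu sv sw vw nsw; have muv := MU_singular_DP mu sv.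
have nd (z : lit) : z.1 = w -> ldeg (DP v F) z != 1.
  by move=> zw; apply/eqP => d; apply: nsw; apply/(singularP _ muv); exists z.
have [x [C [xv mainC]]] := singular_main mu sv.
have [y [D [yw mainD]]] := singular_main mu sw.
have xy : y.1 != x.1 by rewrite xv yw eq_sym.
have yC : y \in C.
  apply/negPn/negP => yC; have := nd y yw; rewrite -xv.
  by rewrite (ldeg_DP_notin mu mainC) // (main_ldeg mainD).
have eD : C = D by case: mainC => CF _ _; case: mainD => _ _; apply.
subst D; have yC' : comp y \notin C by have [CF _ _] := mainC; exact: (proj1 mu).
exists x, y; split=> //; split; first by rewrite eq_sym.
- have := nd y yw; rewrite -xv (ldeg_DP_main mu mainC) //.
  have [CF xC _] := mainC; have [E EF xE] := MU_no_pure mu CF xC.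
  by have := ldeg_gt0 EF xE; case: ldeg => [|[]].
- have := nd (comp y) yw; rewrite -xv (ldeg_DP_notin mu mainC) //.
  have [CF _ _] := mainC; have [E EF yE] := MU_no_pure mu CF yC.
  by have := ldeg_gt0 EF yE; case: ldeg => [|[]].
- by exists C.
Qed.

(** The same degree computation read backwards: the two literals on the variable of [y] end with the
    degrees of [comp x] and [comp y]. *)
Lemma blocked_nonsingular (F : clauseset) x y : MU F -> blocked F x y ->
  ~ singular (DP x.1 F) y.1.
Proof.
move=> mu [xy dx dy [C mainx mainy]].
have yx : y.1 != x.1 by rewrite eq_sym.
have [CF yC _] := mainy.
move/(singularP _ (MU_DP mu mainx)) => [z /lit_same_var []->].
  by rewrite (ldeg_DP_main mu mainx) // => e; rewrite e in dx.
rewrite (ldeg_DP_notin mu mainx) //; last exact: (proj1 mu).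
by move=> e; rewrite e in dy.
Qed.

(* Literals of the common main clause [C] have degree at least two after
   reducing [x.1], so a literal of degree one lies outside of [C], and then
   neither reduction changes its degree. *)
Lemma blocked_transfer (F : clauseset) x y u : MU F -> blocked F x y ->
  singular (DP x.1 F) u -> singular F u /\ singular (DP y.1 F) u.
Proof.
move=> mu bl su; have nsy := blocked_nonsingular mu bl.
have [xy dx dy [C mainx mainy]] := bl.
have ux : u != x.1.
  by apply: (singular_DP_neq mu) su; apply/(singularP _ mu); exists x; rewrite ?(main_ldeg mainx).
have uy : u != y.1 by apply/eqP => e; rewrite -e in nsy.
have /(singularP _ (MU_DP mu mainx)) [z zu dz] := su.
rewrite -zu in ux uy *.
have zC : z \notin C.
  apply/negP => zC; have := ldeg_DP_in mu mainx ux zC.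
  by rewrite dz leqNgt dx.
rewrite (ldeg_DP_notin mu mainx) // in dz.
split; first by apply/(singularP _ mu); exists z.
by apply/(singularP _ (MU_DP mu mainy)); exists z; rewrite ?(ldeg_DP_notin mu mainy).
Qed.

(** Failure in one order produces a blocked pair, and blocking is symmetric. *)
Lemma singular_DP_sym (F : clauseset) v w : MU F ->
  singular F v -> singular F w -> v != w ->
  singular (DP v F) w -> singular (DP w F) v.
Proof.
move=> mu sv sw vw sDw; apply: NNPP => ns.
have [|y [x [yw xv bl]]] := blockedP mu sw sv _ ns; first by rewrite eq_sym.
by apply: (blocked_nonsingular mu (blocked_sym bl)); rewrite xv yw.
Qed.

(** * Lengths of maximal singular tuples *)

Lemma maximal_singular_nil F : maximal_singular_tuple F [::] <-> nonsingular F.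
Proof. by split=> [[]|]. Qed.

Lemma maximal_singular_cons F v s :
  maximal_singular_tuple F (v :: s) <->
  singular F v /\ maximal_singular_tuple (DP v F) s.
Proof.
split=> [[st ns]|[sv [st ns]]].
  by split; [exact: (st 0) | split=> // i si; exact: (st i.+1)].
by split=> // -[|i] si //=; exact: st.
Qed.

Lemma maximal_singular_exists (F : clauseset) : MU F ->
  exists s, maximal_singular_tuple F s.
Proof.
have [n] := ubnP #|` F|; elim: n F => // n IH F ltFn mu.
case: (classic (nonsingular F)) => [ns|].
  by exists [::]; apply/maximal_singular_nil.
move/not_all_not_ex => [v sv].
have [|s ms] := IH (DP v F) _ (MU_singular_DP mu sv).
  by rewrite card_singular_DP.
by exists (v :: s); apply/maximal_singular_cons.
Qed.

Lemma maximal_singular_size (F : clauseset) s t : MU F ->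
  maximal_singular_tuple F s -> maximal_singular_tuple F t -> size s = size t.
Proof.
have [n] := ubnP #|` F|; elim: n F s t => // n IH F s t ltFn mu.
have IHDP v s' t' : singular F v -> maximal_singular_tuple (DP v F) s' ->
    maximal_singular_tuple (DP v F) t' -> size s' = size t'.
  move=> sv; apply: IH; last exact: MU_singular_DP.
  by rewrite card_singular_DP.
have diamond v w s' t' : singular F v -> singular F w -> singular (DP v F) w ->
    maximal_singular_tuple (DP v F) s' -> maximal_singular_tuple (DP w F) t' ->
    size s' = size t'.
  move=> sv sw svw ms mt.
  have vw : v != w by rewrite eq_sym; apply: (singular_DP_neq mu sv).
  have swv := singular_DP_sym mu sv sw vw svw.
  (* Reductions by [v] and [w] commute, so [r] completes both orders. The induction hypothesis
     compares [s'] with [w :: r] and [t'] with [v :: r]. *)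
  have [r mr] := maximal_singular_exists (MU_singular_DP (MU_singular_DP mu sv) svw).
  rewrite (IHDP v s' (w :: r)) //; last by apply/maximal_singular_cons.
  rewrite (IHDP w t' (v :: r)) //; apply/maximal_singular_cons.
  by rewrite -DP_comm.
case: s => [|v s]; case: t => [|w t] //.
- by move=> /maximal_singular_nil ns /maximal_singular_cons [/ns].
- by move=> /maximal_singular_cons [sv _] /maximal_singular_nil /(_ v).
move=> /maximal_singular_cons [sv ms] /maximal_singular_cons [sw mt] /=.
congr _.+1; case: (eqVneq v w) => [e|vw].
  by subst w; exact: (IHDP v).
case: (classic (singular (DP v F) w)) => [svw|nsvw]; first exact: (diamond v w).
have [x [y [xv yw bl]]] := blockedP mu sv sw vw nsvw; subst v w.
(* The blocked pair forms no diamond itself, so [s] and [t] are compared through a maximal tuple of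
   the reduction by a third variable [u]. *)
have common u : singular F u -> singular (DP x.1 F) u -> singular (DP y.1 F) u ->
    size s = size t.
  move=> su sxu syu; have [r mr] := maximal_singular_exists (MU_singular_DP mu su).
  by rewrite (diamond x.1 u s r) // (diamond y.1 u t r).
(* If [s] or [t] is nonempty, its first variable serves as [u]; if both are empty, the lengths agree
   trivially. *)
case: s ms common => [|u s] ms common; last first.
  have /maximal_singular_cons [sxu _] := ms.
  by have [su syu] := blocked_transfer mu bl sxu; exact: (common u).
case: t mt common => [//|u t] mt common.
have /maximal_singular_cons [syu _] := mt.
by have [su sxu] := blocked_transfer mu (blocked_sym bl) syu; exact: (common u).
Qed.

Theorem theorem63 (F : clauseset) :
  MU F ->
  forall s : seq nat, maximal_singular_tuple F s -> is_singind F (size s).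
Proof.
move=> mu s ms; split=> [|t mt]; first by exists s.
by rewrite (maximal_singular_size mu ms mt).
Qed.
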